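(* For every positive integer $n$, the number of minimal separating families of maximum size (i.e. of largest cardinality among all minimal separating families) for an $n$-element set is $n^{n-2}$.
   Context: A bipartition of a set $S$ is a partition of $S$ into at most two nonempty components (so $\{S\}$ is a bipartition). A bipartition cuts two elements if they lie in different components. A family $\mathcal{P}$ of bipartitions of a finite set $S$ is a separating family for $S$ if every two distinct elements of $S$ are cut by some bipartition in $\mathcal{P}$; it is minimal if no proper subfamily is a separating family for $S$. *)

(* Defs.v *)
From mathcomp Require Import all_boot.

Set Implicit Arguments.
Unset Strict Implicit.
Unset Printing Implicit Defensive.

Section SeparatingFamilies.

Variable T : finType.

(* [partition] requires the blocks to be nonempty. *)
Definition bipartition (P : {set {set T}}) : bool :=
  partition P [set: T] && (#|P| <= 2).

Definition cuts (P : {set {set T}}) (x y : T) : bool :=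
  pblock P x != pblock P y.

Definition separating_family (F : {set {set {set T}}}) : bool :=
  [forall P in F, bipartition P] &&
  [forall x : T, forall y : T, (x != y) ==> [exists P in F, cuts P x y]].

Definition minimal_separating_family (F : {set {set {set T}}}) : bool :=
  minset separating_family F.

Definition max_minimal_separating_family (F : {set {set {set T}}}) : bool :=
  minimal_separating_family F &&
  [forall G : {set {set {set T}}},
     minimal_separating_family G ==> (#|G| <= #|F|)].

End SeparatingFamilies.

(* Main.v *)
Require Import Defs.
From mathcomp Require Import all_boot.
From mathcomp Require Import perm zify.

(** Fix a root [r]. Deleting the edges of a tree one at a time gives [n - 1]
    bipartitions, and [x], [y] are cut by as many of them as there are edges
    between [x] and [y]; so the tree is recovered from the pairs cut exactly
    once, and the family is separating and minimal.

    Conversely, in a minimal family [F] every [P] is the only member cutting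
    some pair. Sending [S], a subset of [F], to the mod 2 sum of the sides not
    containing [r] of the members of [S] is then injective into the subsets
    avoiding [r], whence [#|F| <= n - 1]. If equality holds, it is bijective,
    and this makes the graph of the pairs cut exactly once connected; a spanning
    tree of it already has enough edges to account for all members of [F].

    Cayley's formula is proved for forests with root set [S] of size [k], in the
    form [n * #forests = k * n ^ (n - k)]. Attaching a root [w] of a forest with
    root set [w |: S] to a vertex [v] outside the tree of [w] gives every forest
    with root set [S] once. Since the roots play symmetric roles, the tree of
    [w] has on average [n / (k + 1)] vertices. *)

Set Implicit Arguments.
Unset Strict Implicit.
Unset Printing Implicit Defensive.

(** * Reachability under a function, and the effect of changing one value *)

Section FunctionalGraph.

Variable T : finType.
Implicit Types (f g : T -> T) (x y z w s : T).

Lemma fconnect_fixed f s y : f s = s -> fconnect f s y = (s == y).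
Proof.
move=> fs; apply/idP/eqP=> [/iter_findex <-|<-]; last exact: connect0.
by elim: findex => //= k <-.
Qed.

Lemma fconnect_step f x y : fconnect f x y -> x = y \/ fconnect f (f x) y.
Proof.
move/iter_findex; case: findex => [|k]; first by left.
by rewrite iterSr => <-; right; apply: fconnect_iter.
Qed.

Lemma fconnect_total f x y z :
  fconnect f x y -> fconnect f x z -> fconnect f y z || fconnect f z y.
Proof.
move=> /iter_findex <- /iter_findex <-.
move: (findex _ _ y) (findex _ _ z) => i j.
case/orP: (leq_total i j) => /subnK <-; rewrite iterD fconnect_iter ?orbT //.
Qed.

(** By induction along the path, every point reached from [w] leads back to [w]. So [s] does, but a
    fixed point reaches only itself. *)
Lemma fconnect_cycle_fixed f w s :
  f s = s -> fconnect f w s -> fconnect f (f w) w -> w = s.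
Proof.
move=> fs ws cyc; apply/esym/eqP; rewrite -(fconnect_fixed w fs).
rewrite -(iter_findex ws); move: (findex _ _ _) => k.
elim: k => [|k IHk] /=; first exact: connect0.
by case: (fconnect_step IHk) => [->|].
Qed.

Lemma fconnect_antisym f x y s :
  f s = s -> fconnect f x s -> fconnect f x y -> fconnect f y x -> x = y.
Proof.
move=> fs xs xy yx; case: (fconnect_step xy) => // fxy.
have xEs := fconnect_cycle_fixed fs xs (connect_trans fxy yx).
by apply/eqP; rewrite -(@fconnect_fixed f x y) // xEs.
Qed.

(** The [f]-path from [x] is also a [g]-path until it first meets [w]. *)
Lemma fconnect_agree f g w x y : (forall z, z != w -> f z = g z) ->
  fconnect f x y -> fconnect g x y || fconnect g x w.
Proof.
move=> fg /iter_findex <-; move: (findex _ _ _) => k.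
elim: k x => [|k IHk] x; first by rewrite connect0.
rewrite iterSr; have [->|xw] := eqVneq x w; first by rewrite connect0 orbT.
have xg := fconnect1 g x; rewrite -fg // in xg.
by case/orP: (IHk (f x)) => /(connect_trans xg) ->; rewrite ?orbT.
Qed.

Lemma fconnect_agree_at f g w x : (forall z, z != w -> f z = g z) ->
  fconnect f x w = fconnect g x w.
Proof.
move=> fg; have gf z : z != w -> g z = f z by move=> /fg.
by apply/idP/idP => [/(fconnect_agree fg)|/(fconnect_agree gf)]; rewrite orbb.
Qed.

Lemma fconnect_agree_avoid f g w x y : (forall z, z != w -> f z = g z) ->
  ~~ fconnect f x w -> fconnect f x y = fconnect g x y.
Proof.
move=> fg xw; have gf z : z != w -> g z = f z by move=> /fg.
apply/idP/idP => [/(fconnect_agree fg)|/(fconnect_agree gf)].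
  by rewrite -(fconnect_agree_at x fg) (negPf xw) orbF.
by rewrite (negPf xw) orbF.
Qed.

End FunctionalGraph.

(** * Rooted forests and their number *)

Section RootedForests.

Variable T : finType.
Implicit Types (S : {set T}) (f g : {ffun T -> T}) (x y v w s t : T).

(* A forest is encoded by its parent function, fixing exactly the roots [S]. *)
Definition forest S f : bool :=
  [forall s in S, f s == s] && [forall x, exists s in S, fconnect f x s].

Lemma forestP S f :
  reflect ((forall s, s \in S -> f s = s) /\
           (forall x, exists2 s, s \in S & fconnect f x s))
          (forest S f).
Proof.
apply: (iffP andP) => [[/forall_inP fS /forallP reach]|[fS reach]]; split.
- by move=> s /fS /eqP.
- by move=> x; apply/exists_inP.
- by apply/forall_inP=> s /fS ->.
- by apply/forallP=> x; apply/exists_inP.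
Qed.

Definition redirect f w v : {ffun T -> T} :=
  [ffun x => if x == w then v else f x].

Lemma redirect_neq f w v x : x != w -> redirect f w v x = f x.
Proof. by rewrite ffunE => /negPf ->. Qed.

Lemma redirect_eq f w v : redirect f w v w = v.
Proof. by rewrite ffunE eqxx. Qed.

Lemma redirectK f w u v : f w = v -> redirect (redirect f w u) w v = f.
Proof.
by move=> fw; apply/ffunP=> x; rewrite !ffunE; case: eqVneq => // ->.
Qed.

(** A path from [f w] back to [w] would close a cycle, which is impossible since [w] leads to a root
    other than itself. *)
Lemma forest_add_root S f w : w \notin S -> forest S f ->
  forest (w |: S) (redirect f w w) /\ ~~ fconnect (redirect f w w) (f w) w.
Proof.
move=> wS /forestP[fS reach]; set g := redirect f w w.
have fg x : x != w -> f x = g x by move=> xw; rewrite redirect_neq.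
split.
  apply/forestP; split=> [s|x].
    rewrite in_setU1 => /orP[/eqP->|sS]; first exact: redirect_eq.
    by rewrite redirect_neq ?fS //; apply: contraNneq wS => <-.
  have [s sS xs] := reach x; case/orP: (fconnect_agree fg xs) => xs'.
    by exists s; rewrite // setU1r.
  by exists w; rewrite // setU11.
rewrite -(fconnect_agree_at _ fg); apply: contra wS => cyc.
have [s sS ws] := reach w.
by rewrite (fconnect_cycle_fixed (fS s sS) ws cyc).
Qed.

Lemma forest_remove_root S g v w : w \notin S -> forest (w |: S) g ->
  ~~ fconnect g v w -> forest S (redirect g w v).
Proof.
move=> wS /forestP[gS reach] vw; set f := redirect g w v.
have gf x : x != w -> g x = f x by move=> xw; rewrite redirect_neq.
have fv : exists2 s, s \in S & fconnect f v s.
  have [s] := reach v; rewrite in_setU1 => /orP[/eqP->|sS] vs.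
    by rewrite vs in vw.
  by exists s; rewrite // -(fconnect_agree_avoid _ gf).
apply/forestP; split=> [s sS|x].
  by rewrite redirect_neq ?gS ?setU1r //; apply: contraNneq wS => <-.
have [s] := reach x; rewrite in_setU1 => sS xs.
have [xw|xw] := boolP (fconnect f x w).
  have [t tS vt] := fv; exists t => //; apply: connect_trans xw _.
  by apply: connect_trans vt; rewrite -(redirect_eq g w v) fconnect1.
case/orP: sS => [/eqP sw|sS].
  by rewrite -(fconnect_agree_at x gf) -sw xs in xw.
by exists s => //; move: (fconnect_agree gf xs); rewrite (negPf xw) orbF.
Qed.

(** Cutting [w] off from its parent [v] and attaching the root [w] to [v] are inverse to each
    other. *)
Lemma card_forest_parent S v w : w \notin S ->
  #|[set f | forest S f & f w == v]| =
  #|[set g | forest (w |: S) g & ~~ fconnect g v w]|.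
Proof.
move=> wS; set A := [set f | _ & _].
rewrite -(@card_in_imset _ _ (fun f => redirect f w w) A); last first.
  move=> f g; rewrite !inE => /andP[_ /eqP fw] /andP[_ /eqP gw] eq_fg.
  by rewrite -(redirectK w fw) eq_fg redirectK.
apply: eq_card => g; rewrite inE; apply/imsetP/andP.
  move=> [f]; rewrite inE => /andP[Sf /eqP fw] ->.
  by rewrite -fw; apply: forest_add_root.
move=> [Sg vw]; exists (redirect g w v).
  by rewrite inE redirect_eq eqxx andbT; apply: forest_remove_root.
by rewrite redirectK //; have/forestP[-> //] := Sg; rewrite setU11.
Qed.

(* The total size, over all forests, of the tree rooted at [s]. *)
Definition tree_weight S s : nat :=
  \sum_v #|[set f | forest S f & fconnect f v s]|.

Lemma forest_root_unique S f v s t : forest S f -> s \in S -> t \in S ->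
  fconnect f v s -> fconnect f v t -> s = t.
Proof.
move=> /forestP[fS _] sS tS vs vt.
by case/orP: (fconnect_total vs vt); rewrite fconnect_fixed ?fS // => /eqP.
Qed.

Lemma sum_tree_weight S :
  \sum_(s in S) tree_weight S s = #|T| * #|[set f | forest S f]|.
Proof.
rewrite exchange_big /= -sum_nat_const; apply: eq_bigr => v _.
rewrite -sum1_card (eq_bigr (fun s => \sum_(f | forest S f) fconnect f v s)).
  rewrite exchange_big /=.
  under [RHS]eq_bigl => f do rewrite inE.
  apply: eq_bigr => f Sf; have /forestP[_ /(_ v)[s sS vs]] := Sf.
  rewrite (bigD1 s) //= vs big1 ?addn0 // => t /andP[tS ts].
  apply/eqP; rewrite eqb0; apply: contra ts => vt.
  by rewrite (forest_root_unique Sf tS sS vt vs).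
move=> s _; rewrite -sum1_card big_mkcond [RHS]big_mkcond /=.
apply: eq_bigr => f _; rewrite inE.
by case: (forest S _); case: (fconnect _ _ _).
Qed.

Lemma fconnect_conj (p : {perm T}) f g x y : (forall z, g (p z) = p (f z)) ->
  fconnect f x y -> fconnect g (p x) (p y).
Proof.
move=> gp /iter_findex <-; move: (findex _ _ _) => k.
elim: k x => [|k IHk] x; first exact: connect0.
by rewrite iterSr; apply: connect_trans (IHk _); rewrite -gp fconnect1.
Qed.

(** Conjugation by the transposition of [s] and [t] preserves the forests with root set [S] and
    carries the tree of [s] to that of [t]. *)
Lemma tree_weight_le S s t : s \in S -> t \in S ->
  tree_weight S s <= tree_weight S t.
Proof.
move=> sS tS; pose p := tperm s t.
have pS x : x \in S -> p x \in S.
  by move=> xS; rewrite /p; case: tpermP => // ->.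
rewrite [tree_weight S t](reindex_inj (@perm_inj _ p)) /=.
apply: leq_sum => v _; pose c f := [ffun x => p (f (p x))].
have cp f z : c f (p z) = p (f z) by rewrite ffunE tpermK.
have c_inj : injective c.
  move=> f g fg; apply/ffunP=> x; apply: (@perm_inj _ p).
  by rewrite -!cp fg.
rewrite -(card_imset _ c_inj); apply/subset_leq_card/subsetP=> h /imsetP[f].
rewrite !inE => /andP[/forestP[fS reach] vs] ->; apply/andP; split.
  apply/forestP; split=> [x xS|x]; first by rewrite ffunE fS ?pS ?tpermK.
  have [u uS xu] := reach (p x); exists (p u); first exact: pS.
  by rewrite -[x](tpermK s t); apply: fconnect_conj xu.
by have := fconnect_conj (cp f) vs; rewrite {3}/p tpermL.
Qed.

Lemma tree_weight_eq S s t : s \in S -> t \in S ->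
  tree_weight S s = tree_weight S t.
Proof. by move=> sS tS; apply/eqP; rewrite eqn_leq !tree_weight_le. Qed.

(** Let [a] and [b] count the forests with root sets [S] and [w |: S], and let [t] be the weight of
    [w] in the latter. Sorting by the parent of [w] gives [a + t = n * b], and equality of the
    weights gives [(k + 1) * t = n * b], where [k = #|S|]. *)
Lemma card_forest_rec S w : w \notin S ->
  #|S|.+1 * #|[set f | forest S f]| =
  #|S| * (#|T| * #|[set f | forest (w |: S) f]|).
Proof.
move=> wS.
have -> : #|[set f | forest S f]| =
    \sum_v #|[set g | forest (w |: S) g & ~~ fconnect g v w]|.
  rewrite -sum1_card (partition_big (fun f => f w) predT) //=.
  apply: eq_bigr => v _; rewrite -card_forest_parent // -sum1_card.
  by apply: eq_bigl => f; rewrite !inE.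
have split_w : \sum_v #|[set g | forest (w |: S) g & ~~ fconnect g v w]|
    + tree_weight (w |: S) w = #|T| * #|[set f | forest (w |: S) f]|.
  rewrite -big_split /= -sum_nat_const; apply: eq_bigr => v _.
  rewrite -[RHS](cardsID [set f : {ffun T -> T} | fconnect f v w]) [RHS]addnC.
  by congr (_ + _); apply: eq_card => f; rewrite !inE // andbC.
have := sum_tree_weight (w |: S).
rewrite (eq_bigr (fun=> tree_weight (w |: S) w)); last first.
  by move=> s sS; apply: tree_weight_eq; rewrite ?setU11.
rewrite sum_nat_const cardsU1 wS -split_w; nia.
Qed.

Lemma card_forest S :
  #|T| * #|[set f | forest S f]| = #|S| * #|T| ^ (#|T| - #|S|).
Proof.
have [m cS] := ubnP #|~: S|; elim: m S cS => // m IHm S.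
have [E|[w wS] cS] := set_0Vmem (~: S).
  have ST : S = setT by rewrite -[S]setCK E setC0.
  rewrite ST cardsT subnn muln1 => _.
  rewrite (_ : [set f | _] = [set [ffun x => x]]) ?cards1 ?muln1 //.
  apply/setP=> f; rewrite !inE; apply/forestP/eqP => [[fT _]|->].
    by apply/ffunP=> x; rewrite ffunE fT ?inE.
  by split=> [s|x]; [rewrite ffunE | exists x; rewrite ?inE].
rewrite inE in wS; have := cardsC S; have := cardsC (w |: S).
rewrite cardsU1 wS => c1 c2.
have /IHm : #|~: (w |: S)| < m by lia.
have := card_forest_rec wS; rewrite cardsU1 wS /= add1n.
(* The exponent is positive because [w] is outside [S]. *)
rewrite (_ : #|T| - #|S| = (#|T| - #|S|.+1).+1) ?expnS; last by lia.
set a := #|[set f | forest S f]|; set b := #|[set f | forest _ f]|.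
move: (_ ^ _) => e rec IH; apply/eqP; rewrite -(eqn_pmul2l (ltn0Sn #|S|)).
by rewrite mulnCA rec IH; apply/eqP; lia.
Qed.

End RootedForests.

(** * Spanning trees from edges leaving every set that avoids the root *)

Lemma spanning_forest (T : finType) (e : rel T) (r : T) :
  (forall D : {set T}, r \notin D -> D != set0 ->
     exists x y, [/\ x \in D, y \notin D & e x y]) ->
  exists2 f, forest [set r] f & forall x, x != r -> e x (f x).
Proof.
move=> exit.
(* [D] holds the vertices not yet attached, kept as fixed points of [f]; each round attaches some
   [x] in [D] to some [y] outside. *)
suff grow m (D : {set T}) (f : {ffun T -> T}) : #|D| <= m -> r \notin D ->
    f r = r -> {in D, forall x, f x = x} ->
    (forall x, x \notin D -> fconnect f x r) ->
    (forall x, x \notin D -> x != r -> e x (f x)) ->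
    exists2 f, forest [set r] f & forall x, x != r -> e x (f x).
  apply: (grow _ (~: [set r]) [ffun x => x] (leqnn _)).
  - by rewrite !inE eqxx.
  - by rewrite ffunE.
  - by move=> x _; rewrite ffunE.
  - by move=> x; rewrite !inE negbK => /eqP ->.
  - by move=> x; rewrite !inE negbK => /eqP ->; rewrite eqxx.
elim: m D f => [|m IHm] D f.
  rewrite leqn0 cards_eq0 => /eqP -> _ fr _ reach edge.
  exists f; last by move=> x; apply: edge; rewrite inE.
  apply/forestP; split=> [s /set1P -> //|x].
  by exists r; [rewrite inE | apply: reach; rewrite inE].
have [->|D0] := eqVneq D set0.
  by move=> _ *; apply: (IHm set0 f); rewrite ?cards0.
move=> cD rD fr fD reach edge.
have [x [y [xD yD exy]]] := exit D rD D0.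
have xr : x != r by apply: contraNneq rD => <-.
have fg z : z != x -> f z = redirect f x y z by move=> zx; rewrite redirect_neq.
(* Old paths to [r] avoid [x]: as [f] fixes [x], a path through [x] would stop there. *)
have reach' z : z \notin D -> fconnect (redirect f x y) z r.
  move=> zD; have zr := reach z zD.
  rewrite -(fconnect_agree_avoid _ fg) //; apply: contra xr => zx.
  case/orP: (fconnect_total zx zr); last by rewrite fconnect_fixed // eq_sym.
  by rewrite fconnect_fixed // fD.
apply: (IHm (D :\ x) (redirect f x y)).
- by move: cD; rewrite (cardsD1 x) xD.
- by rewrite !inE negb_and rD orbT.
- by rewrite redirect_neq // eq_sym.
- by move=> z /setD1P[zx zD]; rewrite redirect_neq ?fD.
- move=> z; rewrite !inE negb_and negbK => /orP[/eqP ->|/reach' //].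
  apply: connect_trans (reach' y yD).
  by have := fconnect1 (redirect f x y) x; rewrite redirect_eq.
- move=> z; rewrite !inE negb_and negbK.
  have [-> _ _|zx /= zD zr] := eqVneq z x; first by rewrite redirect_eq.
  by rewrite redirect_neq ?edge.
Qed.

(** * Bipartitions, encoded by their side away from [r] *)

Section Bipartitions.

Variable T : finType.
Implicit Types (P Q : {set {set T}}) (F S : {set {set {set T}}}).
Implicit Types (A D : {set T}) (r x y : T).

Lemma separating_familyP F :
  reflect ({in F, forall P, bipartition P} /\
           (forall x y, x != y -> exists2 P, P \in F & cuts P x y))
          (separating_family F).
Proof.
apply: (iffP andP) => [[/forall_inP bF /forallP sF]|[bF sF]]; split=> //.
- by move=> x y xy; have /forallP/(_ y)/implyP/(_ xy)/exists_inP := sF x.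
- exact/forall_inP.
- by apply/forallP=> x; apply/forallP=> y; apply/implyP=> /sF /exists_inP.
Qed.

(** If removing [P] spoils separation, some pair is cut by [P] alone. Conversely, such a pair forces
    [P] into every separating subfamily. *)
Lemma minimal_separating_familyP F :
  reflect (separating_family F /\
           {in F, forall P, exists x y, [set Q in F | cuts Q x y] = [set P]})
          (minimal_separating_family F).
Proof.
apply: (iffP minsetP) => [[sF minF]|[sF wit]]; split=> //; last first.
  move=> G sG GF; apply/eqP; rewrite eqEsubset GF; apply/subsetP=> P PF.
  have [x [y PE]] := wit P PF; have [_ cG] := separating_familyP _ sG.
  have [|Q QG cQ] := cG x y.
    apply: contra_eq_neq PE => ->; apply/eqP=> /setP/(_ P).
    by rewrite !inE eqxx /cuts eqxx andbF.
  suff /set1P <- : Q \in [set P] by [].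
  by rewrite -PE inE cQ (subsetP GF).
move=> P PF.
have [bF cF] := separating_familyP _ sF.
have : ~~ separating_family (F :\ P).
  apply/negP=> sFP; have := minF _ sFP (subD1set _ _).
  by move/setP/(_ P); rewrite !inE eqxx PF.
rewrite negb_and => /orP[/forall_inPn[Q /setD1P[_ /bF ->]] //|].
case/forallPn=> x /forallPn[y]; rewrite negb_imply => /andP[xy none].
exists x, y; have [Q QF cQ] := cF x y xy.
have only R : R \in F -> cuts R x y -> R = P.
  move=> RF cR; apply/eqP; apply: contraNT none => RP.
  by apply/exists_inP; exists R => //; apply/setD1P.
apply/setP=> R; rewrite !inE; apply/andP/eqP => [[]|->]; first exact: only.
by rewrite -{2}(only Q QF cQ).
Qed.

(** For a bipartition this is the block without [r], or the empty set when there is only one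
    block. *)
Definition side r P : {set T} := [set x | cuts P x r].

Definition split A : {set {set T}} := [set A; ~: A].

Lemma side_root r P : r \notin side r P.
Proof. by rewrite inE /cuts eqxx. Qed.

(** Two points outside the block of [r] share a block, since a third block would exceed the
    bound. *)
Lemma cuts_side r P x y : bipartition P ->
  cuts P x y = ((x \in side r P) != (y \in side r P)).
Proof.
move=> /andP[partP cP]; rewrite !inE /cuts.
have memP z : pblock P z \in P.
  by rewrite pblock_mem // (cover_partition partP) inE.
have [->|xr] := eqVneq (pblock P x) (pblock P r).
  by rewrite eq_sym; case: eqVneq.
have [->|yr] := eqVneq (pblock P y) (pblock P r); first by rewrite xr.
apply: contraTF cP => xy; rewrite -ltnNge.
have sub : [set pblock P r; pblock P x; pblock P y] \subset P.
  by apply/subsetP=> A /setUP[/set2P[]->|/set1P->].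
apply: leq_trans (subset_leq_card sub).
rewrite setUC cardsU1 cards2 !inE negb_or yr (eq_sym _ (pblock P x)) xy.
by rewrite eq_sym xr.
Qed.

(** The side determines which pairs are cut, and the blocks are the classes of the relation of not
    being cut. *)
Lemma side_inj r : {in @bipartition T &, injective (side r)}.
Proof.
move=> P Q bP bQ eq_side; have eq_cuts x y : cuts P x y = cuts Q x y.
  by rewrite !(@cuts_side r) // eq_side.
have /andP[partP _] := bP; have /andP[partQ _] := bQ.
rewrite -(equivalence_partition_pblock partP).
rewrite -(equivalence_partition_pblock partQ).
apply: eq_imset => x; apply/setP=> y; rewrite !inE /=.
rewrite -!eq_pblock ?(partition_trivIset partP, partition_trivIset partQ) //;
  try by rewrite (cover_partition partP, cover_partition partQ) inE.
by apply: negb_inj; apply: eq_cuts.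
Qed.

Lemma split_bipartition r A : r \notin A -> A != set0 ->
  bipartition (split A) /\ side r (split A) = A.
Proof.
move=> rA A0; have CA0 : ~: A != set0 by apply/set0Pn; exists r; rewrite inE.
have tiA : trivIset (split A).
  apply/trivIsetP=> B C /set2P[]-> /set2P[]->; rewrite ?eqxx // => _.
    by rewrite -setI_eq0 setICr.
  by rewrite -setI_eq0 setIC setICr.
have inA : A \in split A by rewrite !inE eqxx.
have inC : ~: A \in split A by rewrite !inE eqxx orbT.
split.
  apply/andP; split; last by rewrite cards2; case: eqP.
  apply/and3P; split=> //.
    by apply/eqP; rewrite /cover bigcup_setU !big_set1 setUCr.
  by rewrite !inE ![set0 == _]eq_sym negb_or A0.
have rC : pblock (split A) r = ~: A by rewrite (def_pblock tiA inC) ?inE.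
apply/setP=> x; rewrite inE /cuts rC.
have [xA|xA] := boolP (x \in A).
  rewrite (def_pblock tiA inA xA); apply/negP=> /eqP/setP/(_ x).
  by rewrite inE xA.
by rewrite (def_pblock tiA inC) ?inE // eqxx.
Qed.

End Bipartitions.

(** * Mod 2 sums of sides and the bound on the size of a minimal family *)

Section Parity.

Variables (T : finType) (r : T).
Implicit Types (P Q : {set {set T}}) (F S : {set {set {set T}}}).
Implicit Types (D : {set T}) (x y : T).

Definition odd_side S : {set T} :=
  [set x | odd #|[set P in S | x \in side r P]|].

(** Every member of [S] other than [P] contributes equally to the parities at [x] and [y], so these
    differ exactly when [P] contributes. *)
Lemma odd_side_cut F S P x y : {in F, forall Q, bipartition Q} ->
  S \subset F -> [set Q in F | cuts Q x y] = [set P] ->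
  ((x \in odd_side S) != (y \in odd_side S)) = (P \in S).
Proof.
move=> bF SF PE.
have same Q : Q \in S -> Q != P -> (x \in side r Q) = (y \in side r Q).
  move=> QS QP; have QF := subsetP SF Q QS.
  apply/eqP; rewrite -[_ == _]negbK -cuts_side ?bF //.
  move/setP/(_ Q): PE; by rewrite in_set1 (negPf QP) inE QF /= => ->.
have /andP[PF cP] : (P \in F) && cuts P x y.
  by move/setP/(_ P): PE; rewrite !inE eqxx.
rewrite (cuts_side r _ _ (bF P PF)) in cP.
rewrite 2!inE (cardsD1 P) [in X in _ != X](cardsD1 P) !oddD.
have -> : [set Q in S | x \in side r Q] :\ P =
          [set Q in S | y \in side r Q] :\ P.
  apply/setP=> Q; rewrite in_setD1 [in RHS]in_setD1.
  case: eqVneq => //= QP; rewrite [LHS]in_set [RHS]in_set.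
  by case QS: (Q \in S) => //=; apply: same.
rewrite inE [P \in finset _]inE.
case: (P \in S) => /=; last by rewrite eqxx.
by move: cP; do 2!case: (_ \in side r P) => //=; case: odd.
Qed.

(** Whether [P] is in [S] can be read off [odd_side S] at the pair cut by [P] alone. *)
Lemma odd_side_inj F : minimal_separating_family F ->
  {in powerset F &, injective odd_side}.
Proof.
move=> /minimal_separating_familyP[/separating_familyP[bF _] wit] S S'.
rewrite !inE => SF S'F eqS; apply/setP=> P; have [PF|PF] := boolP (P \in F).
  have [x [y PE]] := wit P PF.
  by rewrite -(odd_side_cut bF SF PE) eqS (odd_side_cut bF S'F PE).
by rewrite !(contraNF (subsetP _ P) PF).
Qed.

Lemma odd_side_sub S : odd_side S \subset ~: [set r].
Proof.
apply/subsetP=> x; rewrite !inE; apply: contraL => /eqP->.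
rewrite (_ : [set P in S | _] = set0) ?cards0 //.
by apply/setP=> P; rewrite !inE /cuts eqxx andbF.
Qed.

Lemma odd_side_image F :
  odd_side @: powerset F \subset powerset (~: [set r]).
Proof.
by apply/subsetP=> _ /imsetP[S _ ->]; rewrite powersetE odd_side_sub.
Qed.

Lemma minimal_card_le F : minimal_separating_family F -> #|F| <= #|T|.-1.
Proof.
move=> /odd_side_inj injF; rewrite -(cardsC1 r) -(leq_exp2l (m := 2)) //.
rewrite -!card_powerset -(card_in_imset injF).
exact/subset_leq_card/odd_side_image.
Qed.

(* Equality in the bound makes [odd_side] onto, so [D = odd_side S] with [S]
   nonempty, and the pair witnessing a member of [S] leaves [D]. *)
Lemma minimal_exit F D : minimal_separating_family F -> #|F| = #|T|.-1 ->
  r \notin D -> D != set0 ->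
  exists x y, [/\ x \in D, y \notin D & #|[set P in F | cuts P x y]| == 1].
Proof.
move=> minF cF rD D0; have injF := odd_side_inj minF.
have /minimal_separating_familyP[/separating_familyP[bF _] wit] := minF.
have /eqP imF : odd_side @: powerset F == powerset (~: [set r]).
  rewrite eqEcard odd_side_image card_in_imset //.
  by rewrite !card_powerset cF cardsC1 /=.
have : D \in powerset (~: [set r]).
  by rewrite inE subsetC sub1set inE.
rewrite -imF => /imsetP[S]; rewrite inE => SF DE.
have [S0|[P PS]] := set_0Vmem S.
  move: D0; rewrite DE S0 => /set0Pn[x]; rewrite inE.
  rewrite (_ : [set _ in _ | _] = set0) ?cards0 //.
  by apply/setP=> P; rewrite !inE.
have [x [y PE]] := wit P (subsetP SF P PS).
have := odd_side_cut bF SF PE; rewrite PS -DE.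
(* The pair may leave [D] in either direction, and cutting is symmetric. *)
have [xD|xD] := boolP (x \in D); have [yD|yD] := boolP (y \in D) => // _.
  by exists x, y; rewrite PE cards1.
exists y, x; split=> //; rewrite -(cards1 P) -PE; apply/eqP/eq_card => Q.
by rewrite !inE /cuts eq_sym.
Qed.

End Parity.

(** * Families obtained from trees, and families of maximum size *)

Section TreeFamilies.

Variables (T : finType) (r : T).
Implicit Types (f g : {ffun T -> T}) (x y z : T).
Implicit Types (P : {set {set T}}) (F : {set {set {set T}}}).

Definition below f x : {set T} := [set y | fconnect f y x].

(** The edges of the tree are indexed by their lower ends [x]; deleting the edge from [x] to [f x]
    leaves [below f x] and its complement. *)
Definition tree_family f : {set {set {set T}}} :=
  [set split (below f x) | x in ~: [set r]].

Lemma tree_root f : forest [set r] f -> f r = r.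
Proof. by case/forestP=> /(_ r) ->; rewrite ?inE. Qed.

Lemma tree_reach f x : forest [set r] f -> fconnect f x r.
Proof. by case/forestP=> _ /(_ x)[s /set1P ->]. Qed.

Lemma tree_antisym f x y : forest [set r] f ->
  fconnect f x y -> fconnect f y x -> x = y.
Proof.
by move=> tf; apply: fconnect_antisym (tree_root tf) (tree_reach x tf).
Qed.

Lemma tree_acyclic f x : forest [set r] f -> x != r -> ~~ fconnect f (f x) x.
Proof.
move=> tf; apply: contra => cyc; apply/eqP.
exact: fconnect_cycle_fixed (tree_root tf) (tree_reach x tf) cyc.
Qed.

Lemma split_belowP f x : forest [set r] f -> x != r ->
  bipartition (split (below f x)) /\ side r (split (below f x)) = below f x.
Proof.
move=> tf xr; apply: split_bipartition.
  by rewrite inE (fconnect_fixed _ (tree_root tf)) eq_sym.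
by apply/set0Pn; exists x; rewrite inE connect0.
Qed.

Lemma cuts_below f x y z : forest [set r] f -> x != r ->
  cuts (split (below f x)) y z = (fconnect f y x != fconnect f z x).
Proof.
move=> tf xr; have [bip sideE] := split_belowP tf xr.
by rewrite (cuts_side r) // sideE !inE.
Qed.

Lemma mem_tree_family f x : x != r -> split (below f x) \in tree_family f.
Proof. by move=> xr; apply: imset_f; rewrite !inE. Qed.

(** Two distinct vertices cannot each lie below the other, so the edge above one of them separates
    them. The ends of an edge are cut only by the member for that edge. *)
Lemma tree_family_minimal f : forest [set r] f ->
  minimal_separating_family (tree_family f).
Proof.
move=> tf; apply/minimal_separating_familyP; split.
  apply/separating_familyP; split=> [P /imsetP[x]|x y xy].
    by rewrite !inE => xr ->; have [] := split_belowP tf xr.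
  have [yx|yx] := boolP (fconnect f y x); last first.
    have xr : x != r by apply: contraNneq yx => ->; apply: tree_reach.
    exists (split (below f x)); first by rewrite mem_tree_family.
    by rewrite cuts_below // connect0 (negPf yx).
  have nxy : ~~ fconnect f x y.
    by apply: contra_neqN xy => xy; apply: tree_antisym xy yx.
  have yr : y != r by apply: contraNneq nxy => ->; apply: tree_reach.
  exists (split (below f y)); first by rewrite mem_tree_family.
  by rewrite cuts_below // connect0 (negPf nxy).
move=> P /imsetP[x]; rewrite !inE => xr ->; exists x, (f x).
apply/setP=> Q; rewrite inE in_set1; apply/andP/eqP => [[]|->]; last first.
  rewrite mem_tree_family // cuts_below // connect0.
  by rewrite (negPf (tree_acyclic tf xr)).
move=> /imsetP[z]; rewrite !inE => zr ->; rewrite cuts_below //.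
have [-> //|zx /negP[]] := eqVneq z x; apply/eqP; apply/idP/idP.
  by case/fconnect_step=> // xz; rewrite xz eqxx in zx.
exact/connect_trans/fconnect1.
Qed.

Lemma card_tree_family f : forest [set r] f -> #|tree_family f| = #|T|.-1.
Proof.
move=> tf; rewrite card_in_imset ?cardsC1 // => x y.
rewrite !inE => xr yr eq_xy.
have [_ sx] := split_belowP tf xr; have [_ sy] := split_belowP tf yr.
have E : below f x = below f y by rewrite -sx -sy eq_xy.
apply: (tree_antisym tf).
  by have := connect0 (frel f) x; move/setP/(_ x): E; rewrite !inE => ->.
by have := connect0 (frel f) y; move/setP/(_ y): E; rewrite !inE => ->.
Qed.

Lemma tree_family_below f g x : forest [set r] f -> forest [set r] g ->
  tree_family f = tree_family g -> below g x \subset below f x.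
Proof.
move=> tf tg fg; have [->|xr] := eqVneq x r.
  by apply/subsetP=> y _; rewrite inE tree_reach.
have : split (below f x) \in tree_family g by rewrite -fg mem_tree_family.
case/imsetP=> y; rewrite !inE => yr eq_split.
have E : below f x = below g y.
  have [_ <-] := split_belowP tf xr; have [_ <-] := split_belowP tg yr.
  by rewrite eq_split.
have xy : fconnect g x y.
  by have := connect0 (frel f) x; move/setP/(_ x): E; rewrite !inE => ->.
rewrite E; apply/subsetP=> z; rewrite !inE => zx.
exact: connect_trans zx xy.
Qed.

(** The family determines the sets [below], hence the descendant order, in which the parent of [x]
    is the first vertex strictly above [x]. *)
Lemma tree_family_inj :
  {in [set f | forest [set r] f] &, injective tree_family}.
Proof.
move=> f g; rewrite !inE => tf tg fg.
have conn x y : fconnect f x y = fconnect g x y.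
  have /setP/(_ x) : below f y = below g y.
    by apply/eqP; rewrite eqEsubset !tree_family_below.
  by rewrite !inE.
apply/ffunP=> x; have [->|xr] := eqVneq x r; first by rewrite !tree_root.
apply: (tree_antisym tf).
  have := fconnect1 g x; rewrite -conn => /fconnect_step[xg|//].
  by have := tree_acyclic tg xr; rewrite -xg connect0.
have := fconnect1 f x; rewrite conn => /fconnect_step[xf|].
  by have := tree_acyclic tf xr; rewrite -xf connect0.
by rewrite conn.
Qed.

(** The path from [y] to the root does not use the edge above [x], so membership in [A] is constant
    along it. *)
Lemma closed_avoid_root f (A : {set T}) x y : forest [set r] f -> r \notin A ->
  (forall z, z != x -> (z \in A) = (f z \in A)) ->
  ~~ fconnect f y x -> y \notin A.
Proof.
move=> tf rA clA; have := iter_findex (tree_reach y tf).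
move: (findex _ _ _) => k.
elim: k y => [|k IHk] y; first by move=> /= ->.
rewrite iterSr => yr yx; rewrite clA; last first.
  by apply: contraNneq yx => ->; apply: connect0.
by apply: IHk => //; apply: contra yx; apply/connect_trans/fconnect1.
Qed.

Lemma closed_below f (A : {set T}) x :
  forest [set r] f -> x != r -> r \notin A ->
  (x \in A) != (f x \in A) ->
  (forall z, z != x -> (z \in A) = (f z \in A)) ->
  A = below f x.
Proof.
move=> tf xr rA cutx clA.
have fxA := closed_avoid_root tf rA clA (tree_acyclic tf xr).
have xA : x \in A by move: cutx; rewrite (negPf fxA); case: (x \in A).
apply/setP=> y; rewrite inE; have [yx|yx] := boolP (fconnect f y x); last first.
  exact/negbTE/(closed_avoid_root tf rA clA).
have := iter_findex yx; move: (findex _ _ _) => k.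
elim: k y {yx} => [|k IHk] y; first by move=> /= ->.
rewrite iterSr => /IHk fyA.
by have [->|yx] := eqVneq y x; last rewrite clA.
Qed.

Lemma minimal_tree_family F : minimal_separating_family F -> #|F| = #|T|.-1 ->
  exists2 f, forest [set r] f & F = tree_family f.
Proof.
move=> minF cF; pose E x y := [set P in F | cuts P x y].
(* Each edge of this tree is cut by exactly one member of [F]. *)
have [f tf edge] := spanning_forest (fun D => @minimal_exit T r F D minF cF).
have /minimal_separating_familyP[/separating_familyP[bF _] wit] := minF.
have fr := tree_root tf; have reach x := tree_reach x tf.
have cutE x P : P \in F -> cuts P x (f x) -> E x (f x) = [set P].
  move=> PF cP; have xr : x != r.
    by apply: contraTneq cP => ->; rewrite fr /cuts eqxx.
  have /cards1P[Q EQ] := edge x xr; rewrite /E EQ; congr [set _].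
  by apply/esym/set1P; rewrite -EQ inE PF.
(* If [P] cut no tree edge, its side would be empty, as membership is constant on paths to [r]; then
   [P] would cut no pair at all. *)
have ex_cut P : P \in F -> exists2 x, x != r & cuts P x (f x).
  move=> PF; apply/exists_inP; apply: contraT => /exists_inPn none.
  have clA z : (z \in side r P) = (f z \in side r P).
    have [->|zr] := eqVneq z r; first by rewrite fr.
    by apply/eqP; have := none z zr; rewrite (cuts_side r) ?bF // negbK.
  have A0 y : y \notin side r P.
    have := iter_findex (reach y); move: (findex _ _ _) => k.
    elim: k y => [|k IHk] y; first by move=> /= ->; apply: side_root.
    by rewrite iterSr clA; apply: IHk.
  have [x [y /setP/(_ P)]] := wit P PF.
  by rewrite !inE eqxx PF (cuts_side r) ?bF // (negPf (A0 x)) (negPf (A0 y)).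
(* [E] takes every value [[set P]], so by counting it is injective and [P] cuts
   a single edge of the tree. *)
have E_inj : {in ~: [set r] &, injective (fun x => E x (f x))}.
  apply/imset_injP; rewrite eqn_leq leq_imset_card cardsC1 -cF.
  rewrite -(card_imset (mem F) (@set1_inj _)); apply/subset_leq_card.
  apply/subsetP=> _ /imsetP[P PF ->]; have [x xr cP] := ex_cut P PF.
  by apply/imsetP; exists x; rewrite ?inE // (cutE x P).
exists f => //; apply/eqP; rewrite eqEcard card_tree_family // cF leqnn andbT.
apply/subsetP=> P PF; have [x xr cP] := ex_cut P PF.
suff sideE : side r P = below f x.
  have [bip sE] := split_belowP tf xr.
  have -> : P = split (below f x).
    by apply: (@side_inj _ r); rewrite ?sE //; apply: bF.
  by rewrite mem_tree_family.
apply: closed_below => //; first exact: side_root.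
  by rewrite -cuts_side ?bF.
(* If [P] also cut the edge above [z], then [E] would take the value [[set P]] on both edges. *)
move=> z zx; apply/eqP; rewrite -[_ == _]negbK -cuts_side ?bF //.
apply: contra zx => cz; have [zr|zr] := eqVneq z r.
  by move: cz; rewrite zr fr /cuts eqxx.
by apply/eqP/E_inj; rewrite ?inE // !(cutE _ P).
Qed.

Lemma max_minimal_separating_familyE F :
  max_minimal_separating_family F =
  minimal_separating_family F && (#|F| == #|T|.-1).
Proof.
apply: andb_id2l => minF; apply/forall_inP/eqP => [maxF|-> G minG]; last first.
  exact: (minimal_card_le r minG).
apply/eqP; rewrite eqn_leq (minimal_card_le r minF) /=.
(* The star centred at [r] shows that the bound is attained. *)
have tf : forest [set r] [ffun=> r].
  apply/forestP; split=> [s /set1P ->|x]; first by rewrite ffunE.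
  by exists r; rewrite ?inE //; have := fconnect1 [ffun=> r] x; rewrite ffunE.
by rewrite -(card_tree_family tf); apply/maxF/tree_family_minimal.
Qed.

Lemma max_minimal_separating_families :
  [set F | max_minimal_separating_family F] =
  tree_family @: [set f | forest [set r] f].
Proof.
apply/setP=> F; rewrite inE max_minimal_separating_familyE.
apply/andP/imsetP => [[minF /eqP cF]|[f]].
  by have [f tf ->] := minimal_tree_family minF cF; exists f; rewrite ?inE.
by rewrite inE => tf ->; rewrite tree_family_minimal ?card_tree_family.
Qed.

End TreeFamilies.

Theorem theorem2p3 (n : nat) (T : finType) (n_gt0 : 0 < n) (cardT : #|T| = n) :
  #|[set F : {set {set {set T}}} | max_minimal_separating_family F]| = n ^ (n - 2).
Proof.
have /card_gt0P[r _] : 0 < #|T| by rewrite cardT.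
rewrite (max_minimal_separating_families r).
rewrite (card_in_imset (@tree_family_inj T r)).
have := card_forest [set r]; rewrite cards1 mul1n cardT.
(* For [n = 1] the truncated exponents [n - 1] and [n - 2] are both 0, so no factor [n] can be split
   off the power. *)
case: n n_gt0 {cardT} => [|[|m]] // _; first by rewrite mul1n.
by rewrite !subSS !subn0 expnS => /eqP; rewrite eqn_pmul2l // => /eqP.
Qed.
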